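(* Let $E\subseteq\mathbb{Z}$. If $E$ is a metric unconditional basic sequence in $\mathcal{C}(\mathbb{T})$, that is, if the Sidon constant of $E$ is asymptotically $1$, then $E$ enjoys property $(\mathcal{I}_\infty)$. The converse does not hold: there is a set $E\subseteq\mathbb{Z}$ that enjoys $(\mathcal{I}_\infty)$ but whose Sidon constant is not asymptotically $1$.
   Context: $\mathbb{T}=\{z\in\mathbb{C}:|z|=1\}$; $e_n(z)=z^n$; $\mathcal{C}(\mathbb{T})$ is the space of continuous complex functions with the sup norm. The Sidon constant of $E\subseteq\mathbb{Z}$ is the infimum of the $C$ (possibly $+\infty$) such that $\sum_{q\in G}|a_q|\le C\|\sum_{q\in G}a_qe_q\|_\infty$ for all finite $G\subseteq E$ and $a_q\in\mathbb{C}$; it equals the complex unconditionality constant of $E$ in $\mathcal{C}(\mathbb{T})$. The Sidon constant of $E$ is asymptotically $1$ (equivalently, $E$ is a complex metric unconditional basic sequence in $\mathcal{C}(\mathbb{T})$) if for each $\varepsilon>0$ there is a finite set $F$ such that the Sidon constant of $E\setminus F$ is less than $1+\varepsilon$. $E$ enjoys $(\mathcal{I}_\infty)$ if for every $m\ge1$ and every $\zeta\in(\mathbb{Z}\setminus\{0\})^m$ with $\zeta_1+\dots+\zeta_m=0$ there is a finite set $G\subseteq E$ such that $\zeta_1r_1+\dots+\zeta_mr_m\ne0$ for all distinct $r_1,\dots,r_m\in E\setminus G$. *)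

(* Defs.v *)
From mathcomp Require Import all_boot all_order all_algebra.
From mathcomp Require Import finmap.
From mathcomp Require Import all_classical all_reals ereal.
From mathcomp Require Import complex.
Set Implicit Arguments.
Unset Strict Implicit.
Unset Printing Implicit Defensive.
Import Order.TTheory GRing.Theory Num.Theory.
Local Open Scope classical_set_scope.
Local Open Scope ring_scope.

(* [Normc.normc] is the modulus as an element of [R]; the [`|z|] of the
   numDomainType [R[i]] is valued in [R[i]]. *)
Definition unit_circle (R : realType) : set R[i] :=
  [set z | Normc.normc z = 1].
Arguments unit_circle R : clear implicits.

Definition sup_norm (R : realType) (f : R[i] -> R[i]) : R :=
  sup [set Normc.normc (f z) | z in unit_circle R].

Definition character_T (R : realType) (q : int) : R[i] -> R[i] :=
  fun z => z ^ q.

Definition trig_poly (R : realType) (G : {fset int}) (a : int -> R[i]) :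
    R[i] -> R[i] :=
  fun z => \sum_(q <- G) a q * character_T q z.

(* The infimum is taken in [\bar R]: it is [+oo] when no [C] is admissible.
   For the empty [E], where every real [C] is admissible, it is [-oo]. *)
Definition sidon_constant (R : realType) (E : set int) : \bar R :=
  ereal_inf [set C%:E | C in [set C : R |
    forall (G : {fset int}) (a : int -> R[i]), [set` G] `<=` E ->
      \sum_(q <- G) Normc.normc (a q) <= C * sup_norm (trig_poly G a)]].

(* Equivalently, [E] is a complex metric unconditional basic sequence in
   C(T), the Sidon constant being the complex unconditionality constant. *)
Definition sidon_asymptotically_one (R : realType) (E : set int) : Prop :=
  forall eps : R, 0 < eps ->
    exists F : set int, finite_set F /\
      (sidon_constant R (E `\` F) < (1 + eps)%:E)%E.

Definition property_I_infty (E : set int) : Prop :=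
  forall (m : nat) (zeta : 'I_m -> int), (1 <= m)%N ->
    (forall i, zeta i != 0) -> \sum_(i < m) zeta i = 0 ->
    exists G : set int, [/\ finite_set G, G `<=` E &
      forall r : 'I_m -> int, injective r -> (forall i, (E `\` G) (r i)) ->
        \sum_(i < m) zeta i * r i != 0].

(* Main.v *)
(* If zeta_1 r_1 + ... + zeta_m r_m = 0 with sum of the zeta_i zero, choose
   unimodular a_i with prod a_i^zeta_i = -1.  Then w_i = a_i z^r_i satisfies
   prod w_i^zeta_i = -1 for every z on the circle, so the w_i cannot all be
   close to each other and |sum a_i z^r_i| <= m - delta, with delta depending on
   zeta only; hence a Sidon constant close to 1 excludes the relation.

   For the counterexample, take blocks of K_n points x on the curve
   x |-> 1 + xB + ... + (xB)^(n-1).  As B is large, the base-B digits of a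
   relation vanish separately, and Vandermonde excludes relations of length
   and total weight at most n.  On the other hand K_n is much larger than the
   logarithm of the frequencies, so that few points of the circle have to be
   controlled and some choice of signs gives a polynomial of norm at most
   (15/16) K_n.  The blocks are dilated by fast growing factors, which decouples
   the relations and preserves the norms. *)

Require Import Defs.
From mathcomp Require Import all_boot all_order all_algebra.
From mathcomp Require Import finmap.
From mathcomp Require Import all_classical all_reals ereal.
From mathcomp Require Import complex.
From mathcomp Require Import zify ring lra.
Set Implicit Arguments.
Unset Strict Implicit.
Unset Printing Implicit Defensive.
Import Order.TTheory GRing.Theory Num.Theory.
Local Open Scope ring_scope.

(** * Elementary inequalities; unimodular complex numbers *)

Lemma absz_sum_le (I : Type) (r : seq I) (P : pred I) (F : I -> int) :
  (`|(\sum_(i <- r | P i) F i)%R| <= \sum_(i <- r | P i) `|F i|)%N.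
Proof.
elim/big_ind2: _ => // a b c d ab cd; rewrite -lez_nat PoszD abszE.
by apply: le_trans (ler_normD _ _) _; rewrite lerD // -abszE lez_nat.
Qed.

Lemma leq_exp2rW m n e : (m <= n)%N -> (m ^ e <= n ^ e)%N.
Proof. by case: e => // e; rewrite leq_exp2r. Qed.

Section Modulus.
Variable R : realType.
Implicit Types (z w u v : R[i]) (q : int).
Local Notation normc := (@Normc.normc R).

Lemma normc_ge0 z : 0 <= normc z.
Proof. by case: z => a b; exact: sqrtr_ge0. Qed.

Lemma normc_sqrE z : normc z ^+ 2 = complex.Re z ^+ 2 + complex.Im z ^+ 2.
Proof. by case: z => a b; rewrite sqr_sqrtr // addr_ge0 ?sqr_ge0. Qed.

Lemma Re_le_normc z : complex.Re z <= normc z.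
Proof.
case: z => a b; rewrite [complex.Re _]/=; apply: (le_trans (ler_norm a)).
by rewrite -sqrtr_sqr ler_wsqrtr // lerDl sqr_ge0.
Qed.

Lemma normcD z w : normc (z + w) <= normc z + normc w.
Proof. exact: le_normcD. Qed.

Lemma normc_sum_le (I : Type) (r : seq I) (P : pred I) (F : I -> R[i]) :
  normc (\sum_(i <- r | P i) F i) <= \sum_(i <- r | P i) normc (F i).
Proof.
elim/big_ind2: _ => [|x a y b xa yb|//]; first by rewrite Normc.normc0.
by apply: le_trans (normcD a b) _; exact: lerD.
Qed.

Lemma normc_unit_neq0 z : normc z = 1 -> z != 0.
Proof.
by apply: contra_eq_neq => ->; rewrite Normc.normc0 eq_sym oner_neq0.
Qed.

Lemma normcX z n : normc (z ^+ n) = normc z ^+ n.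
Proof.
elim: n => [|n IHn]; first by rewrite !expr0 Normc.normc1.
by rewrite !exprS Normc.normcM IHn.
Qed.

Lemma normc_exprz_unit z q : normc z = 1 -> normc (z ^ q) = 1.
Proof.
by case: q => n nz; rewrite ?Normc.normcV -?exprnP normcX nz expr1n ?invr1.
Qed.

Lemma normc_div_unit u v : normc v = 1 -> normc (u / v) = normc u.
Proof. by move=> nv; rewrite Normc.normcM Normc.normcV nv invr1 mulr1. Qed.

Lemma normc_dist_div u v : normc v = 1 -> normc (u / v - 1) = normc (u - v).
Proof.
move=> nv; rewrite -[RHS](normc_div_unit _ nv) mulrBl divff //.
exact: normc_unit_neq0.
Qed.

Lemma normc_distM u v :
  normc u = 1 -> normc (u * v - 1) <= normc (u - 1) + normc (v - 1).
Proof.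
move=> nu; rewrite (_ : u * v - 1 = (u - 1) + u * (v - 1)); last by ring.
by apply: le_trans (normcD _ _) _; rewrite Normc.normcM nu mul1r.
Qed.

Lemma normc_distX u n :
  normc u = 1 -> normc (u ^+ n - 1) <= n%:R * normc (u - 1).
Proof.
move=> nu; elim: n => [|n IHn]; first by rewrite expr0 subrr Normc.normc0 mul0r.
rewrite exprS; apply: le_trans (normc_distM _ nu) _.
by rewrite -natr1 mulrDl mul1r addrC lerD2r.
Qed.

Lemma normc_distXz u q :
  normc u = 1 -> normc (u ^ q - 1) <= `|q|%:R * normc (u - 1).
Proof.
case: q => n nu; first exact: normc_distX.
have nX : normc (u ^+ n.+1) = 1 by rewrite normcX nu expr1n.
rewrite NegzE -exprnN abszN absz_nat.
rewrite (_ : _ - 1 = (u ^+ n.+1)^-1 * - (u ^+ n.+1 - 1)); last first.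
  by rewrite mulrN mulrBr mulr1 mulVf ?normc_unit_neq0 // opprB.
by rewrite Normc.normcM Normc.normcV nX invr1 mul1r normcN normc_distX.
Qed.

Lemma normc_dist_prod (I : finType) (u : I -> R[i]) (q : I -> int) :
  (forall i, normc (u i) = 1) ->
  normc (\prod_i u i ^ q i - 1) <= \sum_i `|q i|%:R * normc (u i - 1).
Proof.
move=> nu; set s := index_enum I.
suff: normc (\prod_(i <- s) u i ^ q i) = 1 /\
      normc (\prod_(i <- s) u i ^ q i - 1) <=
        \sum_(i <- s) `|q i|%:R * normc (u i - 1) by case.
elim: s => [|i s [IH1 IH2]].
  by rewrite !big_nil subrr Normc.normc0 Normc.normc1.
have nui := normc_exprz_unit (q i) (nu i).
rewrite !big_cons Normc.normcM nui IH1 mul1r; split=> //.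
apply: le_trans (normc_distM _ nui) _.
by rewrite lerD ?normc_distXz.
Qed.

(** Used to trade a lower bound on the distance of two points of the circle for an upper bound on
    the modulus of their sum, and conversely. *)
Lemma parallelogram_unit u v : normc u = 1 -> normc v = 1 ->
  normc (u - v) ^+ 2 + normc (u + v) ^+ 2 = 4.
Proof.
move=> /(congr1 (fun x => x ^+ 2)) + /(congr1 (fun x => x ^+ 2)).
rewrite !normc_sqrE; case: u v => [a b] [c d] /=; rewrite !expr1n => h1 h2.
transitivity (2 * (a ^+ 2 + b ^+ 2) + 2 * (c ^+ 2 + d ^+ 2)); first by ring.
by rewrite h1 h2; ring.
Qed.

Lemma rotate_to_real z : exists2 u, normc u = 1 & complex.Re (u * z) = normc z.
Proof.
have [->|z0] := eqVneq z 0.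
  by exists 1; rewrite ?mulr0 ?Normc.normc0 ?Normc.normc1.
have nz : normc z != 0 by apply: contra z0 => /eqP/Normc.eq0_normc ->.
have nnz := normc_sqrE z.
case: z z0 nz nnz => a b _; set N := normc _ => nz /= nnz.
exists (Complex (a / N) (- b / N)) => /=.
  rewrite (_ : _ + _ = 1) ?sqrtr1 //.
  have -> : (a / N) ^+ 2 + (- b / N) ^+ 2 = (a ^+ 2 + b ^+ 2) / N ^+ 2 by field.
  by rewrite -nnz divff // expf_neq0.
have -> : a / N * a - - b / N * b = (a ^+ 2 + b ^+ 2) / N by field.
by rewrite -nnz expr2 mulfK.
Qed.

Lemma unit_root n (c : R[i]) : (0 < n)%N -> normc c = 1 ->
  exists2 u, normc u = 1 & u ^+ n = c.
Proof.
move=> n0 nc; exists (n.-root c); last exact: rootCK.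
apply/eqP; rewrite -(pexpr_eq1 n0) ?normc_ge0 //.
by rewrite -normcX rootCK // nc.
Qed.

End Modulus.

(** * Arithmetic relations keep the Sidon constant away from 1 *)

(** Testing an admissible [C] on this polynomial gives [C > 0] and [1 <= C * (1 - d)]; since
    [(1 - d) * (1 + d) <= 1], this forces [1 + d <= C]. *)
Lemma sidon_constant_ge (R : realType) (E : set int) (K : nat)
    (r : 'I_K -> int) (a : 'I_K -> R[i]) (d : R) :
  (0 < K)%N -> injective r -> (forall i, E (r i)) ->
  (forall i, Normc.normc (a i) = 1) -> 0 < d ->
  (forall z, Normc.normc z = 1 ->
     Normc.normc (\sum_i a i * z ^ r i) <= (1 - d) * K%:R) ->
  ((1 + d)%:E <= sidon_constant R E)%E.
Proof.
move=> K0 rI rE na d0 le_a; apply: le_ereal_inf_tmp => _ [C HC <-].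
pose G : {fset int} := [fset r i | i in 'I_K]%fset.
pose b q : R[i] := \sum_(i | r i == q) a i.
have br i : b (r i) = a i.
  rewrite /b (eq_bigl (pred1 i)) ?big_pred1_eq // => j /=.
  exact: (inj_eq rI).
have sumG (V : nmodType) (F : int -> V) : \sum_(q <- G) F q = \sum_i F (r i).
  rewrite /G big_imfset /=; last by move=> i j _ _ /rI.
  by rewrite big_enum.
have GE : ([set` G] `<=` E)%classic.
  by move=> q /= /imfsetP[i _ ->].
have := HC G b GE; rewrite sumG.
under eq_bigr do rewrite br na.
rewrite sumr_const card_ord => leK.
set s := sup_norm _ in leK.
have PE z : trig_poly G b z = \sum_i a i * z ^ r i.
  by rewrite /trig_poly sumG; under eq_bigr do rewrite br.
(* The supremum is handled as that of a nonempty bounded set: the point 1 of the circle shows that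
   it is nonempty, the assumed estimate that it is bounded. *)
have s_le : s <= (1 - d) * K%:R.
  apply: ge_sup; last by move=> _ [z /= nz <-]; rewrite PE; exact: le_a.
  by exists (Normc.normc (trig_poly G b 1)), 1 => //=; exact: Normc.normc1.
have s_ge0 : 0 <= s.
  apply: le_trans (normc_ge0 (trig_poly G b 1)) _.
  apply: ub_le_sup; last by exists 1 => //; exact: Normc.normc1.
  by exists ((1 - d) * K%:R) => _ [z /= nz <-]; rewrite PE; exact: le_a.
have K0R : 0 < K%:R :> R by rewrite ltr0n.
have C0 : 0 < C.
  rewrite ltNge; apply/negP => C0.
  by have := mulr_le0_ge0 C0 s_ge0; lra.
have le1 : 1 <= C * (1 - d).
  rewrite -(ler_pM2r K0R) mul1r -mulrA.
  by apply: le_trans leK _; rewrite ler_pM2l.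
rewrite lee_fin; nra.
Qed.

Lemma prod_exprz_sum (F : fieldType) (I : finType) (x : F) (q : I -> int) :
  x != 0 -> \prod_i x ^ q i = x ^ (\sum_i q i).
Proof.
by move=> x0; elim/big_rec2: _ => // i a b _ ->; rewrite expfzDr.
Qed.

(* If all the [w i] were close to one of them, say [w j], the product would be
   close to [w j ^ 0 = 1]; so some [w i] is away from [w j], and [|w i + w j|]
   is bounded away from 2. *)
Lemma relation_sum_le (R : realType) (I : finType) (zeta : I -> int)
    (w : I -> R[i]) :
  \sum_i zeta i = 0 -> (forall i, Normc.normc (w i) = 1) ->
  \prod_i w i ^ zeta i = -1 ->
  Normc.normc (\sum_i w i) <= #|I|%:R - ((\sum_i `|zeta i|)%:R ^+ 2)^-1.
Proof.
move=> zeta0 nw prodN1; set S := (\sum_i _)%N.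
have two : Normc.normc (-1 - 1 : R[i]) = 2.
  have := parallelogram_unit (Normc.normc1 R) (Normc.normc1 R).
  rewrite subrr Normc.normc0 -opprD normcN => h.
  apply/eqP; rewrite -(eqrXn2 (n := 2)) ?normc_ge0 //; apply/eqP.
  by move: h; rewrite expr0n /= add0r => ->; ring.
(* If [I] is empty, the empty product would give 1 = -1. *)
case: (pickP (fun _ : I => true)) => [j _|I0]; last first.
  have eN1 : -1 = 1 :> R[i] by rewrite -prodN1 big_pred0.
  move: two; rewrite {1}eN1 subrr Normc.normc0 => /eqP.
  by rewrite eq_sym pnatr_eq0.
have wj0 := normc_unit_neq0 (nw j).
pose u i := w i / w j.
have nu i : Normc.normc (u i) = 1.
  by rewrite normc_div_unit.
have dist_u i : Normc.normc (u i - 1) = Normc.normc (w i - w j).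
  exact: normc_dist_div.
have produ : \prod_i u i ^ zeta i = -1.
  rewrite -prodN1; under eq_bigr do rewrite expfzMl.
  by rewrite big_split /= prod_exprz_sum ?invr_eq0 // zeta0 expr0z mulr1.
have le2 := normc_dist_prod zeta nu.
rewrite produ two in le2.
have S0 : (0 < S)%N.
  rewrite lt0n; apply/eqP => S0; move: le2; rewrite big1 ?ler0n ?lern0 //.
  move=> i _; move/eqP: S0; rewrite sum_nat_eq0.
  move=> /forallP/(_ i)/implyP/(_ isT).
  by move=> /eqP ->; rewrite mul0r.
have SR0 : 0 < S%:R :> R by rewrite ltr0n.
(* Otherwise the weighted sum in [le2] would be less than [S * (2 / S) = 2]; strictness comes from
   an index [k] with nonzero [zeta k]. *)
have [i far] : exists i, 2 / S%:R <= Normc.normc (w i - w j).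
  apply/not_existsP => close.
  suff : \sum_i `|zeta i|%:R * Normc.normc (u i - 1) < 2 by rewrite ltNge le2.
  have [k zk] : exists k, `|zeta k|%N != 0.
    apply/not_existsP => z0; move: S0; rewrite lt0n => /eqP; apply.
    by apply: big1 => k _; apply/eqP; move/negP: (z0 k); rewrite negbK.
  have -> : 2 = \sum_i `|zeta i|%:R * (2 / S%:R) :> R.
    by rewrite -mulr_suml -natr_sum mulrCA divff ?mulr1 // gt_eqF.
  have close' l : Normc.normc (u l - 1) < 2 / S%:R.
    by rewrite dist_u ltNge; apply/negP; exact: close.
  rewrite (bigD1 k) //= [ltRHS](bigD1 k) //= ltr_leD //.
    by rewrite ltr_pM2l // ltr0n lt0n.
  by apply: ler_sum => l _; rewrite ler_wpM2l // ltW.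
have ij : i != j.
  apply: contraTneq far => ->; rewrite subrr Normc.normc0 -ltNge.
  by rewrite divr_gt0.
rewrite (bigD1 i) //= (bigD1 j) 1?eq_sym //= addrA.
apply: le_trans (normcD _ _) _.
have -> : #|I|%:R = 2 + \sum_(k | (k != i) && (k != j)) 1 :> R.
  rewrite -sum1_card natr_sum (bigD1 i) //= (bigD1 j) 1?eq_sym //=.
  by rewrite addrA.
rewrite addrAC lerD //; last first.
  by apply: le_trans (normc_sum_le _ _ _) _; apply: ler_sum => k _; rewrite nw.
have := parallelogram_unit (nw i) (nw j).
set x := Normc.normc (_ - _) in far *; set y := Normc.normc (_ + _).
have Sinv : (S%:R ^+ 2)^-1 = (S%:R^-1) ^+ 2 :> R by rewrite exprVn.
have y0 : 0 <= y by exact: normc_ge0.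
have S1 : S%:R^-1 <= 1 :> R by rewrite invf_le1 // ler1n.
have S2 : 0 < S%:R^-1 :> R by rewrite invr_gt0.
rewrite Sinv; move: far S1 S2; set t := S%:R^-1 => far S1 S2 E4.
(* With [t = 1 / S] this gives [y ^+ 2 <= 4 - 4 * t ^+ 2 <= (2 - t ^+ 2) ^+ 2]. *)
have x2 : 4 * t ^+ 2 <= x ^+ 2.
  have -> : 4 * t ^+ 2 = (2 * t) ^+ 2 by ring.
  by rewrite ler_sqr ?nnegrE ?normc_ge0 // mulr_ge0 // ltW.
rewrite -ler_sqr ?nnegrE //; nra.
Qed.

Lemma asymptotically_one_I_infty (R : realType) (E : set int) :
  sidon_asymptotically_one R E -> property_I_infty E.
Proof.
move=> HE m zeta m0 zeta_neq0 zeta0; set S := (\sum_i `|zeta i|)%N.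
pose i0 := Ordinal m0.
have S0 : (0 < S)%N.
  by rewrite /S (bigD1 i0) //= addn_gt0 absz_gt0 zeta_neq0.
(* Chosen so that [(1 - d) * m] is the bound [m - 1 / S ^+ 2] of [relation_sum_le]. *)
pose d : R := (S%:R ^+ 2 * m%:R)^-1.
have d0 : 0 < d by rewrite invr_gt0 mulr_gt0 ?exprn_gt0 ?ltr0n.
have [F [finF FE]] := HE d d0.
exists (F `&` E)%classic; split.
- exact: finite_setIl.
- exact: subIsetr.
move=> r rI rE; apply/eqP => rel; move: FE; apply/negP; rewrite -leNgt.
have zeta_i0_gt0 : (0 < `|zeta i0|)%N by rewrite absz_gt0.
have normcN1 : Normc.normc (-1 : R[i]) = 1 by rewrite normcN Normc.normc1.
(* One coefficient different from 1 suffices. As -1 is its own inverse, the sign of [zeta i0] does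
   not matter. *)
have [w nw wN1] := unit_root zeta_i0_gt0 normcN1.
have wz : w ^ zeta i0 = -1.
  case: (zeta i0) wN1 => n wN1; first by [].
  by rewrite NegzE -exprnN -[n.+1]absz_nat -abszN -NegzE wN1 invrN1.
pose a i := if i == i0 then w else 1.
apply: (@sidon_constant_ge _ _ m r a) => //.
- by move=> i; have [? nF] := rE i; split=> // Fr; exact: nF.
- by move=> i; rewrite /a; case: eqP => // _; exact: Normc.normc1.
move=> z nz.
have -> : (1 - d) * m%:R = #|'I_m|%:R - (S%:R ^+ 2)^-1.
  by rewrite card_ord /d; field; rewrite !pnatr_eq0 -!lt0n S0 m0.
apply: relation_sum_le => // [i|].
  rewrite Normc.normcM normc_exprz_unit // mulr1 /a.
  by case: eqP => // _; exact: Normc.normc1.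
under eq_bigr do rewrite expfzMl exprz_exp.
rewrite big_split /= prod_exprz_sum ?normc_unit_neq0 //.
rewrite (_ : \sum_i r i * zeta i = 0) ?expr0z ?mulr1; last first.
  by rewrite -[RHS]rel; under eq_bigr do rewrite mulrC.
rewrite (bigD1 i0) //= /a eqxx wz big1 ?mulr1 // => i /negPf ->.
by rewrite exp1rz.
Qed.

(** * Choosing signs that make a polynomial of small norm *)

(** The points are iterated square roots of 1. If [s ^+ 2] is close to [z ^+ 2], then [z - s] and
    [z + s] have a small product, while their squared moduli add up to 4; so one of these is at
    least 2 and the other is at most half the previous bound. *)
Lemma circle_cover (R : realType) k : exists (I : finType) (c : I -> R[i]),
  [/\ #|I| = (2 ^ k)%N, forall i, Normc.normc (c i) = 1 &
      forall z, Normc.normc z = 1 ->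
        exists i, Normc.normc (z - c i) ^+ 2 <= 4 / 2 ^+ k].
Proof.
elim: k => [|k [I [c [cardI nc cover]]]].
  exists unit, (fun=> 1); split=> [|_|z nz]; rewrite ?card_unit //.
    exact: Normc.normc1.
  exists tt; have := parallelogram_unit nz (Normc.normc1 R).
  by rewrite expr0 divr1; have := sqr_ge0 (Normc.normc (z + 1)); lra.
have /choice[s s_spec] i : exists s, Normc.normc s = 1 /\ s ^+ 2 = c i.
  by have [s ns s2] := unit_root (isT : (0 < 2)%N) (nc i); exists s.
exists (I * bool)%type, (fun ib => if ib.2 then s ib.1 else - s ib.1).
split=> [|[i b] /=|z nz].
- by rewrite card_prod card_bool cardI expnS mulnC.
- by have [ns _] := s_spec i; case: b; rewrite ?normcN.
have nz2 : Normc.normc (z ^+ 2) = 1 by rewrite normcX nz expr1n.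
have [i le_i] := cover _ nz2; have [ns s2] := s_spec i.
have par := parallelogram_unit nz ns.
move: le_i; rewrite -s2 subr_sqr Normc.normcM exprMn => le_i.
have -> : 4 / 2 ^+ k.+1 = 4 / 2 ^+ k / 2 :> R.
  by rewrite exprS invfM; ring.
set x := Normc.normc (z - s i) ^+ 2 in par le_i.
set y := Normc.normc (z + s i) ^+ 2 in par le_i.
have x0 : 0 <= x by exact: sqr_ge0.
have y0 : 0 <= y by exact: sqr_ge0.
have [xy|yx] := lerP x y.
  by exists (i, true) => /=; rewrite -/x; nra.
by exists (i, false) => /=; rewrite opprK -/y; nra.
Qed.

(* Signs are chosen one at a time, so that the total weight of the patterns,
   each weighted by 2 to its number of agreements so far, grows at each step by
   a factor at most 3/2, the average over both choices. *)
Lemma disagreeing_signs_weight (I : finType) (p : I -> nat -> bool) K :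
  exists w : nat -> bool,
    (2 ^ K * \sum_c 2 ^ (\sum_(x < K) (w x == p c x)) <= 3 ^ K * #|I|)%N.
Proof.
elim: K => [|K [w IH]].
  exists xpred0; rewrite !expn0 !mul1n -sum1_card.
  by apply: leq_sum => c _; rewrite big_ord0.
pose W c := (2 ^ (\sum_(x < K) (w x == p c x)))%N.
pose ext b x := if x == K then b else w x.
have extE b : (\sum_c 2 ^ (\sum_(x < K.+1) (ext b x == p c x)) =
    \sum_c W c * 2 ^ (b == p c K))%N.
  apply: eq_bigr => c _; rewrite big_ord_recr /= {2}/ext eqxx expnD.
  congr (2 ^ _ * _)%N; apply: eq_bigr => x _.
  by rewrite /ext ltn_eqF.
have avg : (\sum_c W c * 2 ^ (true == p c K) +
    \sum_c W c * 2 ^ (false == p c K) = 3 * \sum_c W c)%N.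
  rewrite -big_split big_distrr; apply: eq_bigr => c _ /=.
  by case: (p c K); rewrite /= ?expn0 ?expn1; lia.
suff [b leb] : exists b,
    (2 * \sum_c W c * 2 ^ (b == p c K) <= 3 * \sum_c W c)%N.
  exists (ext b); rewrite extE !expnS -!mulnA.
  move: IH leb; rewrite -/W; set X := (2 ^ K)%N; set Y := (3 ^ K)%N.
  rewrite -[(\sum_c 2 ^ _)%N]/(\sum_c W c)%N.
  set U := (\sum_c W c)%N; set V := (\sum_c W c * _)%N => IH leb.
  have : (X * (2 * V) <= X * (3 * U))%N by rewrite leq_mul2l leb orbT.
  by lia.
have [le|lt] := leqP (2 * \sum_c W c * 2 ^ (true == p c K)) (3 * \sum_c W c).
  by exists true.
by exists false; lia.
Qed.

(** A pattern with more than [7 * k] agreements would alone have weight at least [2 ^ (7 * k).+1],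
    beyond the total weight [(3 / 2) ^ (8 * k) * 4 ^ k], because [3 ^ 8 * 4 < 2 ^ 15]. *)
Lemma disagreeing_signs (I : finType) (p : I -> nat -> bool) k :
  (#|I| <= 4 ^ k)%N ->
  exists w : nat -> bool,
    forall c, (\sum_(x < 8 * k) (w x == p c x) <= 7 * k)%N.
Proof.
move=> cardI; have [w le_w] := disagreeing_signs_weight p (8 * k).
exists w => c; rewrite leqNgt; apply/negP => gt_c.
have : (2 ^ (8 * k) * 2 ^ (7 * k).+1 <= 3 ^ (8 * k) * 4 ^ k)%N.
  apply: (@leq_trans (3 ^ (8 * k) * #|I|)); last first.
    by rewrite leq_mul2l cardI orbT.
  apply: leq_trans le_w; rewrite leq_mul2l; apply/orP; right.
  by rewrite (bigD1 c) //=; apply: leq_trans (leq_addr _ _); rewrite leq_exp2l.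
rewrite expnS mulnCA -expnD -mulnDl !expnM -expnMn.
have : ((3 ^ 8 * 4) ^ k <= (2 ^ (8 + 7)) ^ k)%N by rewrite leq_exp2rW.
have : (0 < (2 ^ (8 + 7)) ^ k)%N by rewrite !expn_gt0.
set X := ((2 ^ _) ^ k)%N; set Y := (_ ^ k)%N; lia.
Qed.

(** The modulus of the sum is its real part after a rotation [u]. The pair [(z, u)] is replaced by
    one of the [4 ^ k] pairs of grid points, and the signs [w] are chosen to disagree often enough
    with the sign pattern of the real parts at each such pair. *)
Lemma flat_signs (R : realType) (p : nat -> nat) N k :
  (forall x, (x < 8 * k)%N -> (p x <= N)%N) ->
  (16 * N.+1 ^ 2 <= 2 ^ k)%N ->
  exists2 a : nat -> R[i], (forall x, Normc.normc (a x) = 1) &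
    forall z, Normc.normc z = 1 ->
      Normc.normc (\sum_(x < 8 * k) a x * z ^+ p x)
        <= (1 - 16^-1) * (8 * k)%:R.
Proof.
move=> pN Nk; have [I [c [cardI nc cover]]] := circle_cover R k.
pose pat (ij : I * I) x := 0 <= complex.Re (c ij.2 * c ij.1 ^+ p x).
have [|w le_w] := @disagreeing_signs _ pat k.
  by rewrite card_prod cardI -expnMn.
exists (fun x => if w x then 1 else -1) => [x|z nz].
  by case: (w x); rewrite ?normcN Normc.normc1.
have [u nu <-] := rotate_to_real
  (\sum_(x < 8 * k) (if w x then 1 else -1) * z ^+ p x).
have [i zi] := cover _ nz; have [j uj] := cover _ nu.
(* This is where [16 * N.+1 ^ 2 <= 2 ^ k] enters: it turns the mesh of the cover into
   [1 / (2 * N.+1)]. *)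
have prec v : Normc.normc v ^+ 2 <= 4 / 2 ^+ k ->
    Normc.normc v <= (2 * N.+1%:R)^-1 :> R.
  move=> le_v; rewrite -ler_sqr ?nnegrE ?normc_ge0 ?invr_ge0 ?mulr_ge0 //.
  apply: le_trans le_v _; rewrite ler_pdivrMr ?exprn_gt0 // exprVn.
  rewrite mulrC ler_pdivlMr ?exprn_gt0 ?mulr_gt0 ?ltr0n //.
  have : (16 * N.+1 ^ 2)%:R <= (2 ^ k)%:R :> R by rewrite ler_nat.
  by rewrite natrM !natrX; nra.
(* Moving [u] costs one mesh and moving [z] at most [N] of them, and [N.+1] meshes make 1/2. *)
have close x : (x < 8 * k)%N ->
    Normc.normc (u * z ^+ p x - c j * c i ^+ p x) <= 2^-1.
  move=> xk; have n1 : Normc.normc (u / c j) = 1 by rewrite normc_div_unit.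
  have n2 : Normc.normc (z / c i) = 1 by rewrite normc_div_unit.
  have -> : u * z ^+ p x - c j * c i ^+ p x =
      ((u / c j) * (z / c i) ^+ p x - 1) * (c j * c i ^+ p x).
    rewrite mulrBl mul1r mulrACA divfK ?normc_unit_neq0 //.
    by rewrite -exprMn divfK ?normc_unit_neq0.
  rewrite Normc.normcM [X in _ * X]Normc.normcM normcX !nc expr1n !mulr1.
  apply: le_trans (normc_distM _ n1) _.
  apply: le_trans (lerD (lexx _) (normc_distX _ n2)) _.
  rewrite !normc_dist_div //.
  apply: (@le_trans _ _ ((2 * N.+1%:R)^-1 + N%:R * (2 * N.+1%:R)^-1)).
    rewrite lerD ?prec // ler_pM ?normc_ge0 ?prec ?ler_nat ?pN //.
  rewrite -[X in X + _]mul1r -mulrDl addrC natr1 invfM mulrCA.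
  by rewrite divff ?pnatr_eq0 // mulr1.
rewrite mulr_sumr raddf_sum /=.
(* Where the signs disagree, the real part is nonpositive at the grid pair, hence at most 1/2 at
   [(z, u)]; elsewhere it is at most 1. Summing, [4 * k + 7 * k / 2] is 15/16 of [8 * k]. *)
have term (x : 'I_(8 * k)) :
    complex.Re (u * ((if w x then 1 else -1) * z ^+ p x))
      <= 2^-1 + 2^-1 * (w x == pat (i, j) x)%:R.
  have := le_trans (Re_le_normc _) (close x (ltn_ord x)).
  have := close x (ltn_ord x); rewrite -normcN => /(le_trans (Re_le_normc _)).
  have : complex.Re (u * z ^+ p x) <= 1.
    apply: le_trans (Re_le_normc _) _.
    by rewrite Normc.normcM nu normcX nz expr1n mulr1.
  have : - complex.Re (u * z ^+ p x) <= 1.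
    rewrite -raddfN /=; apply: le_trans (Re_le_normc _) _.
    by rewrite normcN Normc.normcM nu normcX nz expr1n mulr1.
  rewrite /pat /=.
  rewrite !raddfN !raddfB /=; set t := u * _; set t' := c j * _.
  case: (w x); rewrite ?mul1r ?mulN1r ?mulrN ?raddfN /= -/t.
    by case: (lerP 0 (complex.Re t')) => /=; lra.
  by case: (lerP 0 (complex.Re t')) => /=; lra.
apply: le_trans (ler_sum _ (fun x _ => term x)) _.
rewrite big_split /= sumr_const card_ord -mulr_sumr -natr_sum -mulr_natl.
have : (\sum_(x < 8 * k) (w x == pat (i, j) x))%:R <= (7 * k)%:R :> R.
  by rewrite ler_nat le_w.
by rewrite !natrM; lra.
Qed.

(** * Independence of points on the curve *)

(** The lowest digit is a multiple of [B] of absolute value less than [B], so it vanishes; dividing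
    by [B] leaves a shorter expansion. *)
Lemma digits_eq0 (B : nat) n (c : nat -> int) :
  (forall j, (j < n)%N -> (`|c j| < B)%N) ->
  \sum_(j < n) c j * B%:Z ^+ j = 0 -> forall j, (j < n)%N -> c j = 0.
Proof.
elim: n c => [//|n IHn] c small; rewrite big_ord_recl expr0 mulr1 => sum0.
have B0 : (0 < B)%N by exact: leq_ltn_trans (leq0n _) (small 0%N isT).
pose T := \sum_(j < n) c j.+1 * B%:Z ^+ j.
have sumE : \sum_(j < n) c (lift ord0 j) * B%:Z ^+ (lift ord0 j) = B%:Z * T.
  by rewrite /T big_distrr; apply: eq_bigr => j _ /=; rewrite exprS mulrCA.
rewrite sumE in sum0; have := small 0%N isT; rewrite /= in sum0.
have -> : c 0%N = - (B%:Z * T) by apply/eqP; rewrite -addr_eq0 sum0.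
rewrite abszN abszM absz_nat -[ltnRHS]muln1 ltn_pmul2l // ltnS leqn0 absz_eq0.
move=> /eqP T0 [|j] ltj; last first.
  by apply: (IHn (fun j => c j.+1)) => // i lti; exact: small.
by move: sum0; rewrite T0 mulr0 addr0.
Qed.

(** The moments combine into the sum of [zeta i * g.[x i]] for any polynomial [g] of size at most
    [n]; a [g] vanishing at all the points but [x i0] isolates [zeta i0]. *)
Lemma vandermonde_independent (I : finType) (P : {pred I})
    (x zeta : I -> int) n :
  {in P &, injective x} -> (#|P| <= n)%N ->
  (forall j, (j < n)%N -> \sum_(i in P) zeta i * x i ^+ j = 0) ->
  forall i, i \in P -> zeta i = 0.
Proof.
move=> xI Pn mom0 i0 Pi0.
pose g := \prod_(k in P | k != i0) ('X - (x k)%:P).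
have sg : (size g <= n)%N.
  rewrite /g -big_filter size_prod_XsubC -sum1_size big_filter.
  by move: Pn; rewrite -sum1_card (bigD1 i0).
have : \sum_(i in P) zeta i * g.[x i] = 0.
  under eq_bigr do rewrite (horner_coef_wide _ sg) big_distrr.
  rewrite exchange_big big1 //= => j _.
  under eq_bigr do rewrite mulrCA.
  by rewrite -big_distrr /= mom0 ?mulr0.
have gE i : g.[x i] = \prod_(k in P | k != i0) (x i - x k).
  by rewrite horner_prod; under eq_bigr do rewrite hornerXsubC.
rewrite (bigD1 i0) //= big1 ?addr0 => [|i /andP[Pi ii0]]; last first.
  by rewrite gE (bigD1 i) ?Pi //= subrr mul0r mulr0.
move=> /eqP; rewrite mulf_eq0 gE => /orP[/eqP //|/prodf_eq0[k /andP[Pk ki0]]].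
by rewrite subr_eq0 => /eqP/xI kE; rewrite kE ?eqxx in ki0.
Qed.

Definition curve (n B x : nat) : nat := \sum_(j < n) (x * B) ^ j.

Lemma curve_inj n B : (1 < n)%N -> (0 < B)%N -> injective (curve n B).
Proof.
move=> n1 B0; apply: incn_inj; apply: leq_mono => x y xy.
rewrite /curve -!(big_mkord predT) big_ltn ?(ltnW n1) //.
rewrite [ltnRHS]big_ltn ?(ltnW n1) //.
rewrite !expn0 ltn_add2l big_ltn // [ltnRHS]big_ltn //.
rewrite !expn1 -addSn leq_add ?ltn_pmul2r //.
by apply: leq_sum => j _; rewrite leq_exp2rW // leq_mul2r (ltnW xy) orbT.
Qed.

Lemma curve_gt0 n B x : (0 < n)%N -> (0 < curve n B x)%N.
Proof. by case: n => // n _; rewrite /curve big_ord_recl. Qed.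

(** The digit of the relation at [B ^ j] is the moment of order [j] of [zeta] at the points [x i],
    of absolute value at most [n * K ^ n < B]. *)
Lemma curve_independent (I : finType) (P : {pred I}) (x : I -> nat)
    (zeta : I -> int) n K B :
  {in P &, injective x} -> (#|P| <= n)%N ->
  (forall i, i \in P -> (x i < K)%N) ->
  (\sum_(i in P) `|zeta i| <= n)%N -> (n * K ^ n < B)%N ->
  \sum_(i in P) zeta i * (curve n B (x i))%:Z = 0 ->
  forall i, i \in P -> zeta i = 0.
Proof.
move=> xI Pn xK zn nB rel.
apply: (@vandermonde_independent _ P (fun i => (x i)%:Z)).
- by move=> i j Pi Pj [] /xI; apply.
- exact: Pn.
apply: (@digits_eq0 B).
  move=> j jn; apply: leq_ltn_trans nB.
  apply: leq_trans (_ : (\sum_(i in P) `|zeta i| * K ^ n)%N <= _)%N; last first.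
    by rewrite -big_distrl leq_mul2r zn orbT.
  apply: (leq_trans (absz_sum_le _ _ _)).
  apply: leq_sum => i Pi; rewrite abszM leq_mul2l abszX absz_nat.
  apply/orP; right.
  apply: leq_trans (_ : (K ^ j <= _)%N).
    by rewrite leq_exp2rW // ltnW ?xK.
  by rewrite leq_pexp2l ?(ltnW jn) // (leq_trans _ (xK i Pi)).
rewrite -[RHS]rel.
under eq_bigr do rewrite big_distrl.
rewrite exchange_big /=; apply: eq_bigr => i _.
rewrite /curve (big_morph Posz PoszD (erefl 0)) big_distrr /=.
apply: eq_bigr => j _.
by rewrite -mulrA -exprMn -PoszM -rmorphXn.
Qed.

(** * Choice of the parameters of a block *)

Lemma exp_dominates d m : exists2 k, (m <= k)%N & (k ^ d <= 2 ^ k)%N.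
Proof.
(* For [k = 2 ^ (e + e)] the claim on exponents is [(e + e) * d <= 2 ^ e * 2 ^ e], which follows
   from [2 * d <= e < 2 ^ e]. *)
pose e := (2 * d + m)%N; exists (2 ^ (e + e))%N.
  by apply: leq_trans (ltnW (ltn_expl _ _)); rewrite // /e; lia.
rewrite -expnM leq_exp2l // expnD.
have : (e.+1 <= 2 ^ e)%N by exact: ltn_expl.
move=> le_e; apply: leq_trans (leq_mul le_e le_e).
by rewrite /e; nia.
Qed.

(** This is the size condition of [flat_signs] for [8 * k] points on the curve, with the least base
    [B] allowed by [curve_independent] and the bound of [curve_le]. For fixed [n] the left side is
    polynomial in [k]. *)
Lemma exp_dominates_curve n : exists2 k, (0 < k)%N &
  (16 * (n * (8 * k * (n * (8 * k) ^ n).+1) ^ n).+1 ^ 2 <= 2 ^ k)%N.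
Proof.
(* With [n], 8 and 16 at most [k], the base is at most [k ^ (2 * n).+2] and the bound on
   frequencies, plus one, at most [k ^ e]; squaring doubles [e] and the factor 16 costs one more
   power. *)
pose e := ((2 * n).+4 * n).+2.
have [k le_k dom] := exp_dominates (e * 2).+1 (n + 16).
have k0 : (0 < k)%N by lia.
exists k => //; apply: leq_trans dom.
have le8 : (8 * k <= k ^ 2)%N by rewrite -mulnn leq_mul2r; lia.
have step (a b c : nat) : (a <= k -> b <= k ^ c -> (a * b).+1 <= k ^ c.+2)%N.
  move=> ak bc; rewrite !expnS.
  have : (a * b <= k * k ^ c)%N by exact: leq_mul.
  have : (0 < k * k ^ c)%N by rewrite muln_gt0 k0 expn_gt0 k0.
  by set X := (k * k ^ c)%N; nia.
have leB : ((n * (8 * k) ^ n).+1 <= k ^ (2 * n).+2)%N.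
  by apply: step; [lia | rewrite expnM leq_exp2rW].
have le_pow : ((8 * k * (n * (8 * k) ^ n).+1) ^ n <= k ^ ((2 * n).+4 * n))%N.
  rewrite expnM leq_exp2rW // -[(2 * n).+4]/(2 + (2 * n).+2)%N expnD.
  exact: leq_mul.
have leN : ((n * (8 * k * (n * (8 * k) ^ n).+1) ^ n).+1 <= k ^ e)%N.
  by apply: step => //; lia.
rewrite [leqRHS]expnS leq_mul //; first by lia.
by rewrite expnM leq_exp2rW.
Qed.

Lemma curve_le n K B x : (x < K)%N -> (0 < B)%N ->
  (curve n B x <= n * (K * B) ^ n)%N.
Proof.
move=> xK B0; rewrite -[n in (n * _)%N]card_ord -sum_nat_const.
apply: leq_sum => j _; apply: (@leq_trans ((K * B) ^ j)).
  by rewrite leq_exp2rW // leq_mul2r (ltnW xK) orbT.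
by rewrite leq_pexp2l ?(ltnW (ltn_ord j)) // muln_gt0 B0 (leq_trans _ xK).
Qed.

(** Stated for a part [P] of the index type so as to apply to those terms of a relation that lie in
    one block. *)
Definition independent_upto n K (p : nat -> nat) :=
  forall (I : finType) (P : {pred I}) (x : I -> nat) (zeta : I -> int),
    {in P &, injective x} -> (#|P| <= n)%N ->
    (forall i, i \in P -> (x i < K)%N) -> (\sum_(i in P) `|zeta i| <= n)%N ->
    \sum_(i in P) zeta i * (p (x i))%:Z = 0 -> forall i, i \in P -> zeta i = 0.

Definition flat_spectrum (R : realType) K (p : nat -> nat) :=
  exists2 a : nat -> R[i], (forall x, Normc.normc (a x) = 1) &
    forall z, Normc.normc z = 1 ->
      Normc.normc (\sum_(x < K) a x * z ^+ p x) <= (1 - 16^-1) * K%:R.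

Lemma independent_flat_block (R : realType) n : exists Kp : nat * (nat -> nat),
  [/\ (0 < Kp.1)%N, injective Kp.2, forall x, (0 < Kp.2 x)%N,
      independent_upto n Kp.1 Kp.2 & flat_spectrum R Kp.1 Kp.2].
Proof.
(* For [n <= 1] the curve is constant; a block for [n.+2] serves as well, independence being
   inherited by smaller bounds. *)
wlog n1 : n / (1 < n)%N => [H|].
  have [[K p] /= [K0 pI p0 ind flat]] := H n.+2 isT; exists (K, p); split=> //.
  move=> I P x zeta xI Pn xK zn; apply: ind => //.
    by apply: leq_trans Pn _; lia.
  by apply: leq_trans zn _; lia.
have [k k0 dom] := exp_dominates_curve n.
pose B := (n * (8 * k) ^ n).+1.
exists (8 * k, curve n B)%N; split=> /=.
- by rewrite muln_gt0.
- exact: curve_inj.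
- by move=> x; apply: curve_gt0; exact: ltnW.
- by move=> I P x zeta xI Pn xK zn; apply: curve_independent xK zn _.
- by apply: flat_signs dom => x xk; exact: curve_le.
Qed.

(** * Union of the dilated blocks *)

(** Here [N l] bounds block [l] before dilation. The factor of [N l] is [dilation N l] written out,
    as the two sequences are defined by mutual recursion. *)
Fixpoint lower_max (N : nat -> nat) n : nat :=
  if n is l.+1 then lower_max N l + (l * (lower_max N l).+1).+1 * N l else 0.

(** Exceeds both [n * lower_max N n], to dominate the lower blocks in a relation of weight at most
    [n], and [n] itself, to push block [n] out of a given finite set. *)
Definition dilation N n := (n * (lower_max N n).+1).+1.

Lemma lower_maxP N l n : (l < n)%N -> (dilation N l * N l <= lower_max N n)%N.
Proof.
elim: n => // n IHn; rewrite ltnS leq_eqVlt => /predU1P[->|/IHn le_n] /=.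
  exact: leq_addl.
exact: leq_trans le_n (leq_addr _ _).
Qed.

Section LacunaryUnion.
Variables (K : nat -> nat) (p : nat -> nat -> nat).

Let N n := (\sum_(x < K n) p n x)%N.
Let point n x : int := (dilation N n * p n x)%:Z.

Definition lacunary_union : set int :=
  [set q | exists n x, (x < K n)%N /\ q = point n x].

Lemma point_le_lower_max l n x : (l < n)%N -> (x < K l)%N ->
  (`|point l x| <= lower_max N n)%N.
Proof.
move=> ln xK; apply: leq_trans (lower_maxP N ln).
rewrite absz_nat leq_mul2l /N (bigD1 (Ordinal xK)) //=.
exact: leq_addr.
Qed.

(** Blocks of index below both-sided bound [n0] on length and weight are discarded. In a relation
    among the other points, the terms of the highest block [n] sum to a multiple of [dilation N n],
    and the remaining terms to less than it in absolute value. So the former sum vanishes, against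
    independence in block [n]. *)
Lemma lacunary_union_I_infty :
  (forall n, independent_upto n (K n) (p n)) -> property_I_infty lacunary_union.
Proof.
move=> ind m zeta m0 zeta_neq0 _.
pose n0 := maxn m (\sum_i `|zeta i|)%N.
exists [set q | exists n x,
  [/\ (n < n0)%N, (x < K n)%N & q = point n x]]%classic.
split=> [||r rI rE].
- apply: sub_finite_set (finite_image Posz (finite_II (lower_max N n0).+1)).
  move=> _ [l [x [ln xK ->]]]; exists `|point l x|%N => //=.
  by rewrite ltnS; exact: point_le_lower_max.
- by move=> q [n [x [_ xK ->]]]; exists n, x.
have /choice[nx nxP] i : exists nx : nat * nat,
    [/\ (n0 <= nx.1)%N, (nx.2 < K nx.1)%N & r i = point nx.1 nx.2].
  have [[n [x [xK rE']]] nG] := rE i; exists (n, x); split=> //=.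
  by rewrite leqNgt; apply/negP => nn0; apply: nG; exists n, x.
have [j _ jmax] := @arg_maxnP _ (Ordinal m0) xpredT (fun i => (nx i).1) isT.
set n := (nx j).1 in jmax; pose P := [pred i | (nx i).1 == n].
have n0n : (n0 <= n)%N by have [] := nxP j.
have le_zeta (Q : pred 'I_m) : (\sum_(i | Q i) `|zeta i| <= n)%N.
  apply: leq_trans n0n; apply: leq_trans (leq_maxr _ _).
  by rewrite [leqRHS](bigID Q) leq_addr.
apply/eqP; rewrite (bigID P) /=.
set low := \sum_(i | _ != n) _.
have low_lt : (`|low| < dilation N n)%N.
  rewrite /dilation ltnS mulnS; apply: leq_trans (leq_addl _ _).
  apply: leq_trans (absz_sum_le _ _ _) _.
  apply: (@leq_trans (\sum_(i | (nx i).1 != n) `|zeta i| * lower_max N n)).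
    apply: leq_sum => i ni; rewrite abszM leq_mul2l.
    have [_ xK ->] := nxP i; rewrite point_le_lower_max ?orbT //.
    by rewrite ltn_neqAle ni; exact: jmax.
  by rewrite -big_distrl leq_mul2r le_zeta orbT.
have -> : \sum_(i | (nx i).1 == n) zeta i * r i =
    (dilation N n)%:Z * \sum_(i in P) zeta i * (p n (nx i).2)%:Z.
  rewrite big_distrr; apply: eq_bigr => i /eqP ni /=.
  by have [_ _ ->] := nxP i; rewrite ni /point PoszM mulrCA.
move=> rel; suff : zeta j = 0 by apply/eqP; exact: zeta_neq0.
apply: (ind n _ P (fun i => (nx i).2) zeta); rewrite ?inE //.
- move=> i i' /eqP ni /eqP ni' xx; apply: rI.
  have [_ _ ->] := nxP i; have [_ _ ->] := nxP i'.
  by rewrite ni ni' xx.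
- apply: leq_trans (max_card _) _; rewrite card_ord.
  exact: leq_trans (leq_maxl _ _) n0n.
- by move=> i /eqP ni; have [_ + _] := nxP i; rewrite ni.
apply/eqP; rewrite -absz_eq0 -leqn0 -ltnS.
rewrite -(ltn_pmul2l (ltn0Sn _ : 0 < dilation N n)%N).
move/eqP: rel; rewrite addr_eq0 => /eqP/(congr1 absz).
by rewrite abszM absz_nat abszN muln1 => ->.
Qed.

(** Any finite set misses some whole block, whose flat polynomial bounds the Sidon constant below by
    [1 + 16^-1]. *)
Lemma lacunary_union_not_asymptotically_one (R : realType) :
  (forall n, [/\ (0 < K n)%N, injective (p n), forall x, (0 < p n x)%N &
                 flat_spectrum R (K n) (p n)]) ->
  ~ sidon_asymptotically_one R lacunary_union.
Proof.
move=> block /(_ 16^-1)[|F [/finite_fsetP[X ->]]]; first by rewrite invr_gt0.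
apply/negP; rewrite -leNgt.
(* No element of [X] exceeds [n] in absolute value, whereas all points of block [n] do. *)
pose n := (\sum_(q <- X) `|q|)%N.
have [K0 pI p0 [a na flat]] := block n.
apply: (@sidon_constant_ge _ _ (K n) (fun x => point n x) (fun x => a x)) => //.
- move=> x y [] /eqP; rewrite eqn_pmul2l // => /eqP/pI; exact: val_inj.
- move=> x; split; first by exists n, x.
  move=> /= xX; suff : (n < n)%N by rewrite ltnn.
  apply: (@leq_trans `|point n x|).
    rewrite absz_nat; apply: leq_trans (leq_pmulr _ (p0 x)).
    by rewrite /dilation ltnS mulnS leq_addr.
  by rewrite [leqRHS](big_rem _ xX) leq_addr.
(* Dilating frequencies amounts to evaluating at a power of [z], again on the circle. *)
move=> z nz; have := flat (z ^+ dilation N n).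
rewrite normcX nz expr1n => /(_ erefl).
by under eq_bigr do rewrite -exprM.
Qed.

End LacunaryUnion.

Theorem corollary3p4p3 :
  forall R : realType,
    (forall E : set int,
       sidon_asymptotically_one R E -> property_I_infty E) /\
    (exists E : set int,
       property_I_infty E /\ ~ sidon_asymptotically_one R E).
Proof.
move=> R; split=> [E|]; first exact: asymptotically_one_I_infty.
have /choice[Kp block] := independent_flat_block R.
exists (lacunary_union (fun n => (Kp n).1) (fun n => (Kp n).2)); split.
  by apply: lacunary_union_I_infty => n; have [] := block n.
by apply: lacunary_union_not_asymptotically_one => n; have [] := block n.
Qed.
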